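(* Let $n\ge 3$ be an integer and let $G$ be a simple graph. Then $G$ is isomorphic to the cycle $C_n$ on $n$ vertices if and only if $$da(G;x,y) = nxy^{n-2} + ny^{n}\sum_{i=2}^{n-1}x^{i} + x^{n}y^{n+2}.$$
   Context: All graphs are finite, simple and have at least one vertex. For a graph $G$, $S\subseteq V(G)$ and $u\in V(G)$, let $\bar S=V(G)\setminus S$, let $\delta_S(u)=|\{v\in S:\{u,v\}\in E(G)\}|$, and let $G[S]$ be the subgraph induced by $S$. The defensive alliance polynomial of $G$ is $$da(G;x,y)=\sum_{S} x^{|S|}\,y^{f_y(S)},\qquad f_y(S)=\min_{u\in S}\bigl(\delta_S(u)-\delta_{\bar S}(u)+|V(G)|\bigr),$$ where the sum runs over all non-empty $S\subseteq V(G)$ such that $G[S]$ is connected (single-vertex graphs are connected). *)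

(* Defs.v *)
From HB Require Import structures.
From mathcomp Require Import all_boot all_order all_algebra.
Set Implicit Arguments.
Unset Strict Implicit.
Unset Printing Implicit Defensive.
Import Order.TTheory GRing.Theory.
Local Open Scope ring_scope.

Record sgraph := SGraph {
  vertex :> finType;
  adj : rel vertex;
  adj_sym : symmetric adj;
  adj_irrefl : irreflexive adj }.

Definition isomorphic (G H : sgraph) : Prop :=
  exists2 f : G -> H, bijective f & forall u v : G, adj (f u) (f v) = adj u v.

Section Cycle.
Variable n : nat.

(* The conjunct [i != j] only matters for the degenerate case n = 1. *)
Definition cycle_adj : rel 'I_n :=
  fun i j => (i != j) && ((i.+1 == j %[mod n]) || (j.+1 == i %[mod n])).

Lemma cycle_adj_sym : symmetric cycle_adj.
Proof. by move=> i j; rewrite /cycle_adj eq_sym orbC. Qed.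

Lemma cycle_adj_irrefl : irreflexive cycle_adj.
Proof. by move=> i; rewrite /cycle_adj eqxx. Qed.

Definition cycle_graph : sgraph := SGraph cycle_adj_sym cycle_adj_irrefl.
End Cycle.

Section Alliance.
Variable G : sgraph.
Implicit Types (S : {set G}) (u : G).

Section Induced.
Variable S : {set G}.

Definition induced_adj : rel {u : G | u \in S} :=
  fun a b => adj (val a) (val b).

Lemma induced_adj_sym : symmetric induced_adj.
Proof. by move=> a b; rewrite /induced_adj adj_sym. Qed.

Lemma induced_adj_irrefl : irreflexive induced_adj.
Proof. by move=> a; rewrite /induced_adj adj_irrefl. Qed.

Definition induced : sgraph := SGraph induced_adj_sym induced_adj_irrefl.
End Induced.

Definition connected (H : sgraph) : bool :=
  [forall a : H, forall b : H, connect (@adj H) a b].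

Definition delta S u : nat := #|[set v in S | adj u v]|.

(* The subtraction in nat never truncates: see [marginE]. *)
Definition margin S u : nat := (delta S u + #|G| - delta (~: S) u)%N.

(* All margins are at most 2 |V(G)| (see [margin_le]), so on a non-empty S the
   default value of the iterated minimum is immaterial: see [fyP]. *)
Definition fy S : nat := \big[minn/(2 * #|G|)%N]_(u in S) margin S u.

Lemma delta_le S u : (delta S u <= #|G|)%N.
Proof. exact: max_card. Qed.

Lemma marginE S u :
  (margin S u)%:Z = (delta S u)%:Z - (delta (~: S) u)%:Z + #|G|%:Z.
Proof.
rewrite /margin -subzn; first by rewrite PoszD addrAC.
by rewrite (leq_trans (delta_le _ _)) ?leq_addl.
Qed.

Lemma margin_le S u : (margin S u <= 2 * #|G|)%N.
Proof.
by rewrite (leq_trans (leq_subr _ _)) // mul2n -addnn leq_add2r delta_le.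
Qed.

Lemma fyP S : S != set0 ->
  (exists2 u, u \in S & fy S = margin S u)
  /\ (forall u, u \in S -> (fy S <= margin S u)%N).
Proof.
move=> /set0Pn[u0 u0S].
have lb u : u \in S -> (fy S <= margin S u)%N.
  by move=> uS; rewrite /fy -minEnat -leEnat bigmin_le_cond.
split=> //.
have: (exists2 u, u \in S & fy S = margin S u) \/ fy S = (2 * #|G|)%N.
  rewrite /fy; apply: (big_ind (fun m =>
    (exists2 u, u \in S & m = margin S u) \/ m = (2 * #|G|)%N)).
  - by right.
  - by move=> a b; rewrite /minn; case: ifP.
  - by move=> u uS; left; exists u.
case=> // fyE; exists u0 => //.
by apply/eqP; rewrite eqn_leq lb // fyE margin_le.
Qed.

End Alliance.

(* Bivariate polynomials are {poly {poly int}}: the outer indeterminate is x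
   and the embedded inner one is y. *)
Definition varx : {poly {poly int}} := 'X.
Definition vary : {poly {poly int}} := ('X)%:P.

Definition da (G : sgraph) : {poly {poly int}} :=
  \sum_(S : {set G} | (S != set0) && connected (induced S))
    varx ^+ #|S| * vary ^+ fy S.

(* Main.v *)
(* The coefficients of x and x^n already determine the graph: the first says
   that there are n vertices, all of degree 2, and the second that the whole
   graph is connected; a connected 2-regular graph is a cycle.  Conversely, the
   connected proper subsets of a cycle are its arcs, n of each size, and in a
   connected 2-regular graph a connected proper subset with at least two
   vertices has an end vertex, which makes f_y equal to n. *)
Require Import Defs.
From HB Require Import structures.
From mathcomp Require Import all_boot all_order all_algebra.
From mathcomp Require Import zify.
Set Implicit Arguments.
Unset Strict Implicit.
Unset Printing Implicit Defensive.
Import GRing.Theory.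

(** * Connected vertex sets through closed subsets *)

Definition conn (G : sgraph) (S : {set G}) : bool :=
  (S != set0) && connected (induced S).

Definition regular (G : sgraph) (d : nat) : Prop :=
  forall u : G, #|[set v | adj u v]| = d.

(** This trades paths in the induced subgraph for closed subsets of [S]: paths cannot leave a closed
    subset, and conversely the vertices reachable from a given one form a closed subset. *)
Lemma connectedP (G : sgraph) (S : {set G}) :
  reflect (forall A : {set G}, A \subset S -> A != set0 ->
             (forall u v, u \in A -> v \in S -> adj u v -> v \in A) -> A = S)
          (connected (induced S)).
Proof.
apply: (iffP idP) => [/forallP cS A sAS /set0Pn[u uA] clA | H].
  apply/eqP; rewrite eqEsubset sAS; apply/subsetP => v vS.
  have uS := subsetP sAS u uA.
  have /forallP/(_ (exist _ v vS)) cuv := cS (exist _ u uS).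
  pose B := [pred x : induced S | val x \in A].
  have clB : closed (@adj (induced S)) B.
    apply: intro_closed.
      by apply: sym_connect_sym; exact: adj_sym.
    by move=> x y exy; rewrite !inE => xA; exact: clA xA (valP y) exy.
  have := closed_connect clB cuv.
  by rewrite !inE /= uA => <-.
apply/forallP => a; apply/forallP => b.
pose A := [set val x | x in [pred x : induced S | connect (@adj _) a x]].
have AS : A = S.
  apply: H.
  - by apply/subsetP => _ /imsetP[x _ ->]; exact: valP x.
  - by apply/set0Pn; exists (val a); apply/imsetP; exists a; rewrite ?inE ?connect0.
  - move=> u v /imsetP[x]; rewrite inE => ax -> vS xv.
    apply/imsetP; exists (exist _ v vS) => //; rewrite inE.
    by apply: connect_trans ax (connect1 _).
have : val b \in A by rewrite AS; exact: valP b.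
by case/imsetP=> x; rewrite inE => ax /val_inj ->.
Qed.

Lemma conn1 (G : sgraph) (u : G) : conn [set u].
Proof.
rewrite /conn -card_gt0 cards1; apply/connectedP => A sA A0 _.
by apply/eqP; rewrite eqEcard sA cards1 card_gt0.
Qed.

(** * Margins and the exponent [fy] in terms of degrees *)

Lemma delta_compl (G : sgraph) (S : {set G}) (u : G) :
  delta S u + delta (~: S) u = #|[set v | adj u v]|.
Proof.
rewrite -(cardsID S [set v | adj u v]); congr (_ + _); apply: eq_card => v;
  by rewrite !inE // andbC.
Qed.

(** The two deltas add up to the degree, so only [delta S u] and the degree matter; in degree 2 the
    margin is [#|G| - 2 + 2 * delta S u]. *)
Lemma marginT (G : sgraph) (S : {set G}) (u : G) :
  margin S u + #|[set v | adj u v]| = 2 * delta S u + #|G|.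
Proof.
have := delta_compl S u; have := delta_le (~: S) u; rewrite /margin.
set a := delta _ _; set b := delta _ _; lia.
Qed.

Lemma fy_eq (G : sgraph) (S : {set G}) (m : nat) (w : G) :
  w \in S -> margin S w <= m -> (forall u, u \in S -> m <= margin S u) ->
  fy S = m.
Proof.
move=> wS wm lb.
have [|[u uS fyE] le] := @fyP G S; first by apply/set0Pn; exists w.
by apply/eqP; rewrite eqn_leq (leq_trans (le w wS) wm) fyE lb.
Qed.

Lemma fy1 (G : sgraph) (u : G) :
  fy [set u] + #|[set v | adj u v]| = #|G|.
Proof.
have -> : fy [set u] = margin [set u] u.
  by apply: (@fy_eq _ _ _ u); rewrite ?inE // => v /set1P ->.
rewrite marginT (_ : delta _ _ = 0) //; apply/eqP; rewrite cards_eq0.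
apply/eqP/setP => v; rewrite !inE; apply/andP => -[/eqP->].
by rewrite adj_irrefl.
Qed.

(** If [u] had no neighbour in [S], then [[set u]] would be closed in [S]. *)
Lemma conn_delta_gt0 (G : sgraph) (S : {set G}) (u : G) :
  conn S -> 1 < #|S| -> u \in S -> 0 < delta S u.
Proof.
case/andP=> _ /connectedP cS S1 uS; rewrite lt0n; apply/eqP => d0.
suff E : [set u] = S by rewrite -E cards1 in S1.
apply: cS; rewrite ?sub1set // -?card_gt0 ?cards1 // => x v /set1P -> vS uv.
have /eqP := d0; rewrite cards_eq0 => /eqP/setP/(_ v).
by rewrite !inE vS uv.
Qed.

Lemma conn_exit (G : sgraph) (S : {set G}) :
  conn [set: G] -> S != set0 -> S != [set: G] ->
  exists2 u, u \in S & 0 < delta (~: S) u.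
Proof.
case/andP=> _ /connectedP cG S0 ST.
case: (boolP [exists u in S, 0 < delta (~: S) u]) => [/exists_inP // | /exists_inPn H].
case/eqP: ST; apply: cG; rewrite ?subsetT // => u v uS _ uv.
apply/negPn/negP => vS; case/negP: (H u uS).
by apply/card_gt0P; exists v; rewrite !inE vS.
Qed.

(** Each vertex of [S] has a neighbour in [S], so its margin is at least [#|G|]; a vertex with a
    neighbour outside has only one inside and attains this bound. *)
Lemma fy_conn_regular2 (G : sgraph) (S : {set G}) :
  regular G 2 -> conn [set: G] -> conn S -> 1 < #|S| < #|G| -> fy S = #|G|.
Proof.
move=> reg cG cS /andP[S1 SG].
have [] := @conn_exit G S cG.
- by case/andP: cS.
- by apply: contraTneq SG => ->; rewrite cardsT ltnn.
move=> w wS w0; apply: (@fy_eq _ _ _ w) => // [|u uS].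
  by have := marginT S w; have := delta_compl S w; rewrite reg; lia.
have := marginT S u; have := conn_delta_gt0 cS S1 uS; rewrite reg; lia.
Qed.

Lemma fyT_regular2 (G : sgraph) :
  0 < #|G| -> regular G 2 -> fy [set: G] = #|G| + 2.
Proof.
move=> /card_gt0P[w _] reg.
have mE u : margin [set: G] u = #|G| + 2.
  have := marginT [set: G] u; rewrite reg.
  suff -> : delta [set: G] u = 2 by lia.
  by rewrite -(reg u); apply: eq_card => v; rewrite !inE.
by apply: (@fy_eq _ _ _ w); rewrite ?inE ?mE // => u _; rewrite mE.
Qed.

(** * Rotations and arcs *)

(** A permutation with a single orbit whose steps are the edges: this presents a cycle without
    modular arithmetic. *)
Definition rotation (G : sgraph) (s : G -> G) : Prop :=
  [/\ injective s, forall x y, fconnect s x y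
    & forall u v, adj u v = (s u == v) || (s v == u)].

Definition arc (T : finType) (s : T -> T) (a : T) (k : nat) : {set T} :=
  [set iter i s a | i : 'I_k].

Lemma mem_arc (T : finType) (s : T -> T) (a : T) (k i : nat) :
  i < k -> iter i s a \in arc s a k.
Proof. by move=> ik; apply/imsetP; exists (Ordinal ik). Qed.

Lemma arcP (T : finType) (s : T -> T) (a : T) (k : nat) (x : T) :
  x \in arc s a k -> exists2 i, i < k & x = iter i s a.
Proof. by case/imsetP=> i _ ->; exists i. Qed.

Lemma order_rotation (G : sgraph) (s : G -> G) (a : G) :
  rotation s -> order s a = #|G|.
Proof. by case=> _ tr _; apply: eq_card => x; rewrite !inE; exact: tr. Qed.

Lemma iter_inj_rotation (G : sgraph) (s : G -> G) (a : G) (i j : nat) :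
  rotation s -> i < #|G| -> j < #|G| -> iter i s a = iter j s a -> i = j.
Proof.
move=> rs; rewrite -(order_rotation a rs) => ia ja e.
by rewrite -(findex_iter ia) e findex_iter.
Qed.

Lemma card_arc (G : sgraph) (s : G -> G) (a : G) (k : nat) :
  rotation s -> k <= #|G| -> #|arc s a k| = k.
Proof.
move=> rs kG; rewrite card_imset ?card_ord // => i j e; apply: val_inj.
by apply: (iter_inj_rotation rs _ _ e); rewrite (leq_trans (ltn_ord _)).
Qed.

(** If [a] came later on the arc from [b], its predecessor would lie on the arc from [a], so [a]
    would recur after at most [k] steps, which [k < #|G|] forbids. *)
Lemma arc_inj (G : sgraph) (s : G -> G) (k : nat) :
  rotation s -> 0 < k < #|G| -> injective (fun a => arc s a k).
Proof.
move=> rs /andP[k0 kG] a b /= e.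
have := mem_arc s a k0; rewrite e => /arcP[[|i] ik //= aE].
have := mem_arc s b (ltnW ik); rewrite -e => /arcP[m mk mE].
have : iter 0 s a = iter m.+1 s a by rewrite /= -mE.
by move/(iter_inj_rotation rs (leq_ltn_trans (leq0n k) kG) (leq_ltn_trans mk kG)).
Qed.

Lemma conn_arc (G : sgraph) (s : G -> G) (a : G) (k : nat) :
  rotation s -> 0 < k -> conn (arc s a k).
Proof.
move=> rs k0; apply/andP; split.
  by apply/set0Pn; exists a; exact: (mem_arc s a k0).
have [_ _ adjE] := rs.
apply/connectedP => A sA /set0Pn[x xA] cl.
(* A closed part of the arc reaches [a] going backwards, and from [a] every point going forwards. *)
have aA : a \in A.
  have /arcP[i ik xE] := subsetP sA x xA; rewrite {x}xE in xA.
  elim: i ik xA => //= i IH ik xA; apply: (IH (ltnW ik)).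
  by apply: cl xA (mem_arc _ _ (ltnW ik)) _; rewrite adjE eqxx orbT.
apply/eqP; rewrite eqEsubset sA; apply/subsetP => _ /arcP[i ik ->].
elim: i ik => //= i IH ik.
by apply: cl (IH (ltnW ik)) (mem_arc _ _ ik) _; rewrite adjE eqxx.
Qed.

(** The arc starts where the rotation enters [S] and ends just before the first exit. Both outer
    neighbours of the arc lie outside [S], so it is closed in [S]. *)
Lemma conn_is_arc (G : sgraph) (s : G -> G) (S : {set G}) :
  rotation s -> conn S -> #|S| < #|G| -> exists a, S = arc s a #|S|.
Proof.
move=> rs /andP[S0 /connectedP cS] SG; have [inj tr adjE] := rs.
have [z zS] : exists z, z \notin S.
  have: 0 < #|~: S| by rewrite cardsCs setCK subn_gt0.
  by case/card_gt0P=> z; rewrite inE; exists z.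
have [a aS a_first] : exists2 a, a \in S & forall b, s b = a -> b \notin S.
  case: (boolP [exists b, (b \notin S) && (s b \in S)]).
    by case/existsP=> b /andP[bS sbS]; exists (s b) => // c /inj ->.
  (* If the rotation never entered [S], the orbit of [z] would stay outside, yet it contains [x]. *)
  move/existsPn=> H; have [x xS] := set0Pn _ S0.
  suff: x \notin S by rewrite xS.
  rewrite -(iter_findex (tr z x)); elim: (findex s z x) => //= i IH.
  by have := H (iter i s z); rewrite IH.
have exk : exists m, iter m s a \notin S.
  by exists (findex s a z); rewrite iter_findex.
case: (ex_minnP exk) => k kS kmin.
have kG : k <= #|G|.
  apply: (leq_trans (n := findex s a z)).
    by apply: kmin; rewrite iter_findex.
  by rewrite ltnW // -(order_rotation a rs) findex_max.
have k0 : 0 < k by case: (k) kS => //=; rewrite aS.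
have sub : arc s a k \subset S.
  apply/subsetP => _ /arcP[i ik ->]; apply/negPn/negP => /kmin.
  by rewrite leqNgt ik.
suff E : arc s a k = S by exists a; rewrite -E card_arc.
apply: cS => //; first by apply/set0Pn; exists a; exact: (mem_arc s a k0).
move=> _ v /arcP[i ik ->] vS; rewrite adjE => /orP[/eqP e|/eqP].
  have := ik; rewrite leq_eqVlt => /orP[/eqP e'|]; last first.
    by move/(mem_arc s a); rewrite /= e.
  by move: kS; rewrite -e' /= e vS.
case: i ik => [_ /= /a_first|i ik /= /inj ->]; first by rewrite vS.
exact: mem_arc (ltnW ik).
Qed.

Lemma connT_rotation (G : sgraph) (s : G -> G) :
  0 < #|G| -> rotation s -> conn [set: G].
Proof.
move=> G0 rs; have /card_gt0P[a _] := G0.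
suff <- : arc s a #|G| = [set: G].
  exact: conn_arc.
by apply/eqP; rewrite eqEcard subsetT cardsT card_arc /=.
Qed.

Lemma card_conn_rotation (G : sgraph) (s : G -> G) (k : nat) :
  rotation s -> 0 < k < #|G| ->
  #|[set S : {set G} | conn S & #|S| == k]| = #|G|.
Proof.
move=> rs kG; have /andP[k0 kn] := kG.
rewrite -(card_imset predT (arc_inj rs kG)).
apply: eq_card => S; rewrite inE; apply/andP/imsetP.
  move=> [cS /eqP Sk]; have [|a] := @conn_is_arc G s S rs cS.
    by rewrite Sk.
  by rewrite Sk => ->; exists a.
by case=> a _ ->; rewrite conn_arc // card_arc // ltnW.
Qed.

(** The neighbours of [u] are its successor and its predecessor; if they coincided, two steps would
    lead from [u] back to [u]. *)
Lemma regular_rotation (G : sgraph) (s : G -> G) :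
  2 < #|G| -> rotation s -> regular G 2.
Proof.
move=> G3 rs u; have [inj _ adjE] := rs.
have -> : [set v | adj u v] = [set s u; finv s u].
  apply/setP => v; rewrite !inE adjE eq_sym; congr (_ || _).
  by rewrite -(inj_eq inj v) f_finv.
rewrite cards2; case: eqP => // e; have := congr1 s e; rewrite f_finv //.
by move=> /(@iter_inj_rotation _ _ u 2 0 rs G3 (ltnW (ltnW G3))).
Qed.

(** * The rotation of a cycle graph *)

Lemma iter_ordS (n : nat) (i : 'I_n) (m : nat) :
  iter m (@ordS n) i = (i + m) %% n :> nat.
Proof.
elim: m => [|m IH] /=; first by rewrite addn0 modn_small.
by rewrite IH -addn1 modnDml -addnA addn1.
Qed.

Lemma rotation_of_isomorphic (n : nat) (G : sgraph) :
  1 < n -> isomorphic G (cycle_graph n) ->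
  #|G| = n /\ exists s : G -> G, rotation s.
Proof.
move=> n1 [f bf fadj]; split.
  by rewrite (bij_eq_card bf) card_ord.
have [g fK gK] := bf; exists (fun x => g (ordS (f x))); split.
- by move=> x y /(can_inj gK)/(bij_inj (ordS_bij n))/(can_inj fK).
- move=> x y; set s := (fun x => _).
  have sE m : iter m s x = g (iter m (@ordS n) (f x)).
    by elim: m => [|m IH] /=; rewrite ?fK // IH /s gK.
  (* The exponent is [f y - f x] modulo [n], shifted by [n] to remain a natural number. *)
  have -> : y = iter (n - f x + f y) s x; last exact: fconnect_iter.
  rewrite sE -[LHS]fK; congr g; apply: (@val_inj _ _ 'I_n); rewrite /=.
  rewrite iter_ordS addnA subnKC ?modnDl ?modn_small //.
  exact: ltnW (ltn_ord _).
- move=> u v; rewrite -fadj /= /cycle_adj.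
  have E (i j : 'I_n) : (i.+1 == j %[mod n]) = (ordS i == j).
    by rewrite -val_eqE /= (modn_small (ltn_ord j)).
  rewrite !E !(can2_eq gK fK).
  (* On the diagonal it remains to see that [ordS] has no fixed point, by [1 < n]; the last index,
     which wraps to 0, is treated apart. *)
  case: (f u =P f v) => //= ->; rewrite orbb; apply/esym/negbTE.
  rewrite -val_eqE /=; have := ltn_ord (f v); rewrite leq_eqVlt.
  case/orP=> [/eqP e|lt]; last by rewrite modn_small //; lia.
  by rewrite e modnn; lia.
Qed.

Lemma cycle_regular (n : nat) : 2 < n -> regular (cycle_graph n) 2.
Proof.
move=> n3; have [||cn [s]] := @rotation_of_isomorphic n (cycle_graph n).
- exact: ltnW.
- by exists id => //; exists id.
by move=> rs; apply: (regular_rotation _ rs); rewrite cn.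
Qed.

(** * Connected 2-regular graphs are cycles *)

(** Equal degrees force [f] to map each neighbourhood onto a neighbourhood. Hence its image is
    closed, so it is all of [G], and edges are reflected as well. *)
Lemma regular_embedding_isomorphic (d : nat) (G H : sgraph) (f : H -> G) :
  regular G d -> regular H d -> conn [set: G] -> 0 < #|H| ->
  injective f -> (forall a b, adj a b -> adj (f a) (f b)) -> isomorphic G H.
Proof.
move=> rG rH /andP[_ /connectedP cG] /card_gt0P[h0 _] finj fadj.
have nbr a : f @: [set b | adj a b] = [set v | adj (f a) v].
  apply/eqP; rewrite eqEcard card_imset // rG rH leqnn andbT.
  by apply/subsetP => _ /imsetP[b ab ->]; move: ab; rewrite !inE; exact: fadj.
have onto : f @: setT = [set: G].
  apply: cG; first exact: subsetT.
    by apply/set0Pn; exists (f h0); rewrite imset_f.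
  move=> _ v /imsetP[a _ ->] _ av.
  have : v \in f @: [set b | adj a b] by rewrite nbr inE.
  by case/imsetP=> b _ ->; rewrite imset_f.
have [g fK gK] : bijective f.
  apply: (inj_card_bij finj).
  by rewrite -cardsT -onto card_imset // cardsT.
exists g; first by exists f.
move=> u v; rewrite -{2}(gK u) -{2}(gK v).
have := nbr (g u) => /setP/(_ (f (g v))); rewrite inE => <-.
by rewrite mem_imset // inE.
Qed.

(* A closed simple walk appears at the first repetition of a non-backtracking
   walk: the repeated vertex must be the starting one, since any other already
   has both its neighbours on the walk. *)
Lemma regular2_closed_walk (G : sgraph) :
  0 < #|G| -> regular G 2 ->
  exists k (v : nat -> G), [/\ 2 < k, v k = v 0,
    forall i, adj (v i) (v i.+1)
    & forall i j, i < k -> j < k -> v i = v j -> i = j].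
Proof.
move=> /card_gt0P[x0 _] reg.
have ex_next (x y : G) : {z | adj y z && (z != x)}.
  apply/sigW; have : 0 < #|[set z | adj y z] :\ x|.
    by have := cardsD1 x [set z | adj y z]; rewrite reg; case: (_ \in _) => /=; lia.
  by case/card_gt0P=> z; rewrite !inE andbC; exists z.
(* A state is the pair of previous and current vertex, so that the next one can avoid the previous
   one. *)
pose step (d : G * G) := (d.2, sval (ex_next d.1 d.2)).
pose w i := iter i step (x0, sval (ex_next x0 x0)).
pose v i := (w i).1.
have vS i : v i.+1 = (w i).2 by [].
have vSS i : adj (v i.+1) (v i.+2) && (v i.+2 != v i).
  by rewrite vS; exact: (svalP (ex_next (w i).1 (w i).2)).
have vadj i : adj (v i) (v i.+1).
  case: i => [|i]; last by case/andP: (vSS i).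
  by case/andP: (svalP (ex_next x0 x0)).
have nbr i x : adj (v i.+1) x -> x = v i \/ x = v i.+2.
  move=> ax; have /andP[a1 ne] := vSS i.
  have E : [set v i; v i.+2] = [set z | adj (v i.+1) z].
    apply/eqP; rewrite eqEcard reg cards2 eq_sym ne andbT.
    by apply/subsetP => z; rewrite !inE => /orP[]/eqP->; rewrite // adj_sym.
  have : x \in [set v i; v i.+2] by rewrite E inE.
  by rewrite !inE => /orP[]/eqP->; [left|right].
pose rep k := [exists i : 'I_k, v i == v k].
(* By pigeonhole, the first [#|G|.+1] vertices of the walk contain a repetition. *)
have ex_rep : exists k, rep k.
  case: (boolP [exists k : 'I_#|G|.+1, rep k]) => [/existsP[k ?]|/existsPn H].
    by exists k.
  have: injective (fun i : 'I_#|G|.+1 => v i).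
    have lt (i j : 'I_#|G|.+1) : i < j -> v i <> v j.
      move=> ij e; case/negP: (H j); apply/existsP.
      by exists (Ordinal ij); rewrite /= e.
    move=> i j e; apply: val_inj => /=.
    by case: (ltngtP i j) => // /lt; rewrite e.
  by move/leq_card; rewrite card_ord ltnn.
case: (ex_minnP ex_rep) => k /existsP[i /eqP vik] kmin.
have kinj a b : a < b -> b < k -> v a <> v b.
  move=> ab bk e; have : rep b.
    by apply/existsP; exists (Ordinal ab); rewrite /= e.
  by move/kmin; rewrite leqNgt bk.
have irr a : v a <> v a.+1.
  by move=> e; have := vadj a; rewrite -e adj_irrefl.
have nb a : v a <> v a.+2.
  by move=> e; have /andP[_] := vSS a; rewrite -e eqxx.
case: i vik => -[|i] ik /= vik; last first.
  exfalso; case: k kmin kinj ik vik {ex_rep} => // k kmin kinj ik vik.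
  have: adj (v i.+1) (v k) by rewrite vik adj_sym.
  case/nbr => e.
    by apply: (kinj i k) => //.
  have: i.+1 <= k by [].
  (* The equality [v k = v i.+2] is an earlier repetition only if [i.+2 < k]; the two shorter cases
     would be a loop and a backtrack. *)
  rewrite leq_eqVlt => /orP[/eqP e1|]; first by apply: (irr i.+1); rewrite vik e1.
  rewrite leq_eqVlt => /orP[/eqP e1|lt]; first by apply: (nb i.+1); rewrite vik e1.
  by apply: (kinj i.+2 k).
exists k, v; split=> //.
- case: k ik vik {kmin kinj} => [//|[|[|//]]] _ e; first by case: (irr 0).
  by case: (nb 0).
- move=> a b ak bk e; case: (ltngtP a b) => // ab.
    by case: (kinj a b).
  by case: (kinj b a).
Qed.

(** The closed walk embeds a cycle of length [k] between graphs of equal degree, which gives an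
    isomorphism; counting vertices then yields [k = #|G|]. *)
Lemma conn_regular2_isomorphic (G : sgraph) :
  0 < #|G| -> regular G 2 -> conn [set: G] -> isomorphic G (cycle_graph #|G|).
Proof.
move=> G0 reg cG; have [k [v [k3 vk vadj vinj]]] := regular2_closed_walk G0 reg.
have iso : isomorphic G (cycle_graph k).
  apply: (@regular_embedding_isomorphic 2 _ _ (fun i : cycle_graph k => v i)) => //.
  - exact: cycle_regular.
  - by rewrite card_ord (leq_trans _ k3).
  - by move=> i j /vinj e; apply: val_inj; apply: e.
  (* The edge from the last index back to 0 comes from [v k = v 0]. *)
  have step (i j : 'I_k) : i.+1 == j %[mod k] -> adj (v i) (v j).
    rewrite (modn_small (ltn_ord j)); have := ltn_ord i; rewrite leq_eqVlt.
    case/orP=> [/eqP e|lt]; last by rewrite modn_small // => /eqP <-.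
    by rewrite e modnn => /eqP <-; rewrite -vk; have := vadj i; rewrite e.
  by move=> i j /andP[_ /orP[]/step //]; rewrite adj_sym.
by have [|-> _] := rotation_of_isomorphic _ iso; first exact: ltnW.
Qed.

(** * Coefficients of powers of x *)

Local Open Scope ring_scope.

Lemma coef_da (G : sgraph) (k : nat) :
  (da G)`_k = \sum_(S : {set G} | conn S && (#|S| == k)) 'X^(fy S).
Proof.
rewrite /da coef_sum [RHS]big_mkcondr /=; apply: eq_bigr => S _.
rewrite /varx /vary -polyC_exp mulrC coefCM coefXn eq_sym.
by case: eqP; rewrite ?mulr1 ?mulr0.
Qed.

Lemma coef1_da (G : sgraph) : (da G)`_1 = \sum_(u : G) 'X^(fy [set u]).
Proof.
rewrite coef_da -(big_imset (h := @set1 G) (A := predT) (fun S => 'X^(fy S))).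
  apply: eq_bigl => S; apply/andP/imsetP.
    by move=> [_ /cards1P[u ->]]; exists u.
  by move=> [u _ ->]; rewrite conn1 cards1.
by move=> u v _ _; exact: set1_inj.
Qed.

(** The three summands occupy disjoint ranges of degrees in x; the boolean factors select the one
    that contains [k]. *)
Lemma coef_cycle_poly (n k : nat) : (3 <= n)%N ->
  (n%:R * varx * vary ^+ (n - 2)
   + n%:R * vary ^+ n * (\sum_(2 <= i < n) varx ^+ i)
   + varx ^+ n * vary ^+ (n + 2))`_k =
  (k == 1%N)%:R * (n%:R * 'X^(n - 2)) + (2 <= k < n)%N%:R * (n%:R * 'X^n)
   + (k == n)%:R * 'X^(n + 2) :> {poly int}.
Proof.
move=> n3; set sx := \sum_(_ <= _ < _) _.
have -> : n%:R * varx * vary ^+ (n - 2) + n%:R * vary ^+ n * sx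
    + varx ^+ n * vary ^+ (n + 2)
  = (n%:R * 'X^(n - 2))%:P * 'X + (n%:R * 'X^n)%:P * sx + ('X^(n + 2))%:P * 'X^n.
  by rewrite !polyCM !polyC_exp !polyC_natr mulrAC [varx ^+ n * _]mulrC.
rewrite !coefD !coefCM coefX coefXn coef_sum.
congr (_ + _ + _); rewrite mulrC //; congr (_ * _).
under eq_bigr => i _ do rewrite coefXn.
case: (boolP (2 <= k < n)%N) => H.
  rewrite (bigD1_seq k) ?mem_index_iota ?iota_uniq //= eqxx big1 ?addr0 //.
  by move=> i; rewrite eq_sym => /negbTE ->.
rewrite big_seq big1 // => i; rewrite mem_index_iota.
by case: eqP => // <- H'; rewrite H' in H.
Qed.

(** * Isomorphism with the cycle and the polynomial identity *)

Theorem proposition17 (n : nat) (n_ge3 : (3 <= n)%N) (G : sgraph)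
    (G_nonempty : (0 < #|G|)%N) :
  isomorphic G (cycle_graph n) <->
  da G = n%:R * varx * vary ^+ (n - 2)
         + n%:R * vary ^+ n * (\sum_(2 <= i < n) varx ^+ i)
         + varx ^+ n * vary ^+ (n + 2).
Proof.
split=> [iso | daE].
  have [Gn [s rs]] := rotation_of_isomorphic (ltnW n_ge3) iso.
  have reg : regular G 2 by apply: regular_rotation rs; rewrite Gn.
  have cG := connT_rotation G_nonempty rs.
  apply/polyP => k; rewrite coef_cycle_poly //.
  (* There are [n] connected sets of each such size, so a common exponent determines the
     coefficient. *)
  have count c : (0 < k < n)%N ->
      (forall S : {set G}, conn S -> #|S| = k -> fy S = c) ->
      (da G)`_k = n%:R * 'X^c.
    move=> kn fyc; rewrite coef_da.
    under eq_bigr => S /andP[cS /eqP Sk] do rewrite (fyc S cS Sk).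
    rewrite (eq_bigl (mem [set S : {set G} | conn S & #|S| == k])) => [|S].
      by rewrite sumr_const (card_conn_rotation rs) ?Gn // mulr_natl.
    by rewrite !inE.
  case: (ltngtP k n) => [kn|nk|->]; last 1 first.
  - rewrite andbF mul0r addr0 (_ : (n == 1)%N = false); last by lia.
    rewrite mul0r add0r mul1r coef_da (big_pred1 [set: G]).
      by rewrite fyT_regular2 // Gn.
    move=> S /=; apply/andP/eqP => [[_ /eqP Sn]|->]; last by rewrite cardsT Gn.
    by apply/eqP; rewrite eqEcard subsetT cardsT Sn Gn leqnn.
  - rewrite mul0r addr0; case: k kn count => [|[|k]] kn count.
    + rewrite !mul0r addr0 coef_da big_pred0 // => S.
      by rewrite /conn cards_eq0; case: eqP => //= _; rewrite andbF.
    + rewrite mul1r mul0r addr0; apply: count => [|S _ /eqP/cards1P[u ->]].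
        exact: ltnW.
      by have := fy1 u; rewrite reg Gn; lia.
    + rewrite mul0r add0r mul1r; apply: count => // S cS Sk.
      by rewrite -[RHS]Gn; apply: fy_conn_regular2; rewrite // Sk Gn.
  - rewrite andbF !mul0r !addr0 (_ : (k == 1)%N = false); last by lia.
    rewrite mul0r coef_da big_pred0 // => S; apply/andP => -[_ /eqP Sk].
    by have := max_card (mem S); rewrite Sk Gn leqNgt nk.
have coefE k := coef_cycle_poly k n_ge3; rewrite -daE in coefE.
have c1 : \sum_(u : G) 'X^(fy [set u]) = n%:R * 'X^(n - 2) :> {poly int}.
  rewrite -coef1_da coefE /= mul1r mul0r addr0.
  by rewrite (_ : (1 == n)%N = false) ?mul0r ?addr0 //; case: (n) n_ge3 => [|[|]].
have Gn : #|G| = n.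
  (* At y = 1 every monomial becomes 1, so [c1] compares [#|G|] with [n]. *)
  have := congr1 (fun p : {poly int} => p.[1]) c1.
  rewrite horner_sum; under eq_bigr => u _ do rewrite hornerXn expr1n.
  rewrite sumr_const -polyC_natr hornerCM hornerXn expr1n mulr1 => /eqP.
  by rewrite Num.Theory.eqr_nat => /eqP <-; apply: eq_card.
have reg : regular G 2.
  move=> u; have := fy1 u; rewrite Gn.
  (* Otherwise the coefficient of [c1] at [fy [set u]] would be 0 on the right, but on the left it
     is a sum of nonnegative terms with a 1 from [u]. *)
  suff -> : fy [set u] = (n - 2)%N by lia.
  have := congr1 (fun p : {poly int} => p`_(fy [set u])) c1.
  rewrite coef_sum -polyC_natr coefCM coefXn.
  case: eqP => // _; rewrite mulr0 => /eqP.
  rewrite Num.Theory.psumr_eq0; last by move=> v _; rewrite coefXn Num.Theory.ler0n.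
  by move/allP/(_ u (mem_index_enum u)); rewrite coefXn eqxx.
have cG : conn [set: G].
  (* This coefficient is a nonzero power of y, so some connected set has [n] vertices, that is, all
     of them. *)
  have := coefE n; rewrite coef_da eqxx ltnn andbF mul0r mul1r addr0.
  rewrite (_ : (n == 1)%N = false) ?mul0r ?add0r; last by case: (n) n_ge3 => [|[|]].
  case: (pickP (fun S : {set G} => conn S && (#|S| == n))) => [S|none].
    case/andP=> cS /eqP Sn _; suff <- : S = [set: G] => //.
    by apply/eqP; rewrite eqEcard subsetT cardsT Sn Gn leqnn.
  rewrite big_pred0 // => /eqP; rewrite eq_sym.
  by rewrite expf_eq0 polyX_eq0 andbF.
by rewrite -Gn; exact: conn_regular2_isomorphic.
Qed.
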